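(* The modal logic $\Gamma(\mathbf{LS},2,1)$ has the uniform Lyndon interpolation property.
   Context: Modal formulas use variables, $\bot,\land,\lor,\neg,\to,\Box$. Positive/negative variables: $v^+(p)=\{p\}$, $v^-(p)=\emptyset$, $v^\circ(\bot)=\emptyset$, $\land,\lor,\Box$ preserve polarity ($v^\circ(\varphi\ast\psi)=v^\circ(\varphi)\cup v^\circ(\psi)$, $v^\circ(\Box\varphi)=v^\circ(\varphi)$), $v^\pm(\neg\varphi)=v^\mp(\varphi)$, $v^+(\varphi\to\psi)=v^-(\varphi)\cup v^+(\psi)$, $v^-(\varphi\to\psi)=v^+(\varphi)\cup v^-(\psi)$. $\Gamma(\mathbf{LS},2,1)$ is the set of modal formulas true at every world of every Kripke model on the frame $(W,R)$ with $W=\{r,a,b\}$ and $R$ the reflexive closure of $\{(r,a),(r,b),(a,b),(b,a)\}$ (a root below a two-element final cluster). A logic $L$ has the uniform Lyndon interpolation property iff for every formula $\varphi$ and finite sets $P^+,P^-$ of variables there is $\theta$ with $L\vdash\varphi\to\theta$, $v^\circ(\theta)\subseteq v^\circ(\varphi)\setminus P^\circ$ for $\circ\in\{+,-\}$, and $L\vdash\theta\to\psi$ for every $\psi$ with $L\vdash\varphi\to\psi$ and $v^\circ(\psi)\cap P^\circ=\emptyset$ for $\circ\in\{+,-\}$. *)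

(* Defs.v *)
From HB Require Import structures.
From mathcomp Require Import all_boot.

Set Implicit Arguments.
Unset Strict Implicit.
Unset Printing Implicit Defensive.

Inductive formula : Type :=
| Var of nat
| Bot
| And of formula & formula
| Or of formula & formula
| Neg of formula
| Imp of formula & formula
| Box of formula.

(* [pvars true f] lists v^+(f) and [pvars false f] lists v^-(f); only membership
   in these lists matters. *)
Fixpoint pvars (s : bool) (f : formula) : seq nat :=
  match f with
  | Var p => if s then [:: p] else [::]
  | Bot => [::]
  | And g h | Or g h => pvars s g ++ pvars s h
  | Neg g => pvars (~~ s) g
  | Imp g h => pvars (~~ s) g ++ pvars s h
  | Box g => pvars s g
  end.

Notation vpos := (pvars true).
Notation vneg := (pvars false).

Section Kripke.
Variables (W : finType) (R : rel W).

Fixpoint sat (V : nat -> pred W) (w : W) (f : formula) : bool :=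
  match f with
  | Var p => V p w
  | Bot => false
  | And g h => sat V w g && sat V w h
  | Or g h => sat V w g || sat V w h
  | Neg g => ~~ sat V w g
  | Imp g h => sat V w g ==> sat V w h
  | Box g => [forall u, R w u ==> sat V u g]
  end.

Definition frame_logic (f : formula) : Prop :=
  forall (V : nat -> pred W) (w : W), sat V w f.

End Kripke.

Inductive world := wr | wa | wb.

Definition world_code (w : world) : option bool :=
  match w with wr => None | wa => Some true | wb => Some false end.
Definition world_decode (c : option bool) : world :=
  match c with None => wr | Some true => wa | Some false => wb end.
Lemma world_codeK : cancel world_code world_decode.
Proof. by case. Qed.
HB.instance Definition _ := Finite.copy world (can_type world_codeK).

Definition world_rel : rel world := fun x y =>
  (x == y) || ((x, y) \in [:: (wr, wa); (wr, wb); (wa, wb); (wb, wa)]).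

Definition Gamma_LS_2_1 : formula -> Prop := frame_logic world_rel.

Definition avoids (s P : seq nat) : Prop := forall p, p \in s -> p \notin P.

Definition within_diff (s t P : seq nat) : Prop :=
  forall p, p \in s -> p \in t /\ p \notin P.

Definition uniform_Lyndon_interpolation (L : formula -> Prop) : Prop :=
  forall (phi : formula) (Ppos Pneg : seq nat),
  exists theta : formula,
    [/\ L (Imp phi theta),
        within_diff (vpos theta) (vpos phi) Ppos,
        within_diff (vneg theta) (vneg phi) Pneg
      & forall psi : formula,
          L (Imp phi psi) -> avoids (vpos psi) Ppos -> avoids (vneg psi) Pneg ->
          L (Imp theta psi)].

(* Main.v *)
From mathcomp Require Import all_boot.
Require Import Defs.

Set Implicit Arguments.
Unset Strict Implicit.
Unset Printing Implicit Defensive.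

(** The interpolant is the disjunction, over the finitely many pointed models
    [(V, w)] of [phi], of a formula describing [(V, w)] by the literals of the
    allowed polarities: it records the literal type of [w], and says (by []<>
    and <>[]) that the types of the two final worlds and those of the final
    cluster of the model where it is evaluated cover each other.  A relation
    between two 2-element sets that is total on both sides contains a perfect
    matching.  Hence, if [(V', w')] satisfies this formula, the frame itself,
    with root [(w, w')] and final cluster given by the matching, carries a
    model that projects onto both [(V, w)] and [(V', w')] by bounded morphisms;
    its valuation can be chosen between [V] and [V'] so that [phi] is
    transferred from [V] to it and [psi] from it to [V']. *)

(** * Transfer of truth along bounded morphisms, by polarity *)

Lemma mem_catl (T : eqType) (s1 s2 : seq T) (x : T) : x \in s1 -> x \in s1 ++ s2.
Proof. by rewrite mem_cat => ->. Qed.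

Lemma mem_catr (T : eqType) (s1 s2 : seq T) (x : T) : x \in s2 -> x \in s1 ++ s2.
Proof. by rewrite mem_cat orbC => ->. Qed.

Section BoundedMorphism.
Variables (W1 W2 : finType) (R1 : rel W1) (R2 : rel W2) (f : W1 -> W2).
Hypothesis f_forth : forall x y, R1 x y -> R2 (f x) (f y).
Hypothesis f_back : forall x z, R2 (f x) z -> exists2 y, R1 x y & f y = z.
Variables (V1 : nat -> pred W1) (V2 : nat -> pred W2).

(** One induction handles both directions, since a negation or an antecedent exchanges them:
    flipping [s] there leaves the two hypotheses as they are and reverses the conclusion. *)
Lemma sat_bounded_morphism (g : formula) (s : bool) :
    (forall p, p \in pvars s g -> forall x, V1 p x -> V2 p (f x)) ->
    (forall p, p \in pvars (~~ s) g -> forall x, V2 p (f x) -> V1 p x) ->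
  forall x, if s then sat R1 V1 x g -> sat R2 V2 (f x) g
            else sat R2 V2 (f x) g -> sat R1 V1 x g.
Proof.
elim: g s => [p||g IHg h IHh|g IHg h IHh|g IHg|g IHg h IHh|g IHg] s /= Hpos Hneg x.
- case: s Hpos Hneg => /= Hpos Hneg; [apply: Hpos | apply: Hneg];
    by rewrite inE.
- by case: s {Hpos Hneg}.
- have {}IHg := IHg s (fun p pg => Hpos p (mem_catl _ pg))
                      (fun p pg => Hneg p (mem_catl _ pg)) x.
  have {}IHh := IHh s (fun p ph => Hpos p (mem_catr _ ph))
                      (fun p ph => Hneg p (mem_catr _ ph)) x.
  by case: s {Hpos Hneg} IHg IHh => IHg IHh /andP[/IHg-> /IHh->].
- have {}IHg := IHg s (fun p pg => Hpos p (mem_catl _ pg))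
                      (fun p pg => Hneg p (mem_catl _ pg)) x.
  have {}IHh := IHh s (fun p ph => Hpos p (mem_catr _ ph))
                      (fun p ph => Hneg p (mem_catr _ ph)) x.
  by case: s {Hpos Hneg} IHg IHh => IHg IHh /orP[/IHg->|/IHh->]; rewrite ?orbT.
- have {}IHg := IHg (~~ s) Hpos Hneg x.
  by case: s {Hpos Hneg} IHg => /= IHg; apply: contra.
- have {}IHg := IHg (~~ s) (fun p pg => Hpos p (mem_catl _ pg))
                           (fun p pg => Hneg p (mem_catl _ pg)) x.
  have {}IHh := IHh s (fun p ph => Hpos p (mem_catr _ ph))
                      (fun p ph => Hneg p (mem_catr _ ph)) x.
  by case: s {Hpos Hneg} IHg IHh => /= IHg IHh /implyP gh;
    apply/implyP => /IHg/gh/IHh.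
- have {}IHg := IHg s Hpos Hneg.
  (* Pushing a box forward along [f] uses the back condition; pulling it back uses the forth
     condition. *)
  case: s {Hpos Hneg} IHg => IHg /forallP boxg; apply/forallP => z;
    apply/implyP => Rz.
  + have [y Ry <-] := f_back Rz.
    by apply: IHg; apply: (implyP (boxg y)).
  + by apply: IHg; apply: (implyP (boxg (f z))); apply: f_forth.
Qed.

End BoundedMorphism.

Lemma sat_ext (W : finType) (R : rel W) (V1 V2 : nat -> pred W) (g : formula) :
    (forall p, p \in vpos g ++ vneg g -> V1 p =1 V2 p) ->
  forall x, sat R V1 x g = sat R V2 x g.
Proof.
move=> V12 x.
have idR (y z : W) : R y z -> exists2 t, R y t & t = z by exists z.
have V12s s p : p \in pvars s g -> V1 p =1 V2 p.
  by move=> pg; apply: V12; rewrite mem_cat; case: s pg => ->; rewrite ?orbT.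
apply/idP/idP.
- apply: (@sat_bounded_morphism W W R R id _ idR V1 V2 g true) => // p pg y;
    by rewrite (V12s _ _ pg).
- apply: (@sat_bounded_morphism W W R R id _ idR V1 V2 g false) => // p pg y;
    by rewrite (V12s _ _ pg).
Qed.

Lemma sat_ImpP (W : finType) (R : rel W) (V : nat -> pred W) (w : W)
    (g h : formula) :
  reflect (sat R V w g -> sat R V w h) (sat R V w (Imp g h)).
Proof. exact: implyP. Qed.

(** * Derived connectives and the modalities of the final cluster *)

Definition Dia (g : formula) : formula := Neg (Box (Neg g)).

Definition bigAnd (s : seq formula) : formula := foldr And (Neg Bot) s.
Definition bigOr (s : seq formula) : formula := foldr Or Bot s.

Section BigConnectives.
Variables (W : finType) (R : rel W) (V : nat -> pred W) (w : W).

Lemma sat_bigAnd (s : seq formula) : sat R V w (bigAnd s) = all (sat R V w) s.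
Proof. by elim: s => //= g s ->. Qed.

Lemma sat_bigOr (s : seq formula) : sat R V w (bigOr s) = has (sat R V w) s.
Proof. by elim: s => //= g s ->. Qed.

End BigConnectives.

Lemma pvars_bigAnd (b : bool) (s : seq formula) :
  pvars b (bigAnd s) = flatten (map (pvars b) s).
Proof. by elim: s => [|g s /= ->] //; case: b. Qed.

Lemma pvars_bigOr (b : bool) (s : seq formula) :
  pvars b (bigOr s) = flatten (map (pvars b) s).
Proof. by elim: s => [|g s /= ->]. Qed.

Lemma forall_world (P : pred world) :
  [forall u, P u] = [&& P wr, P wa & P wb].
Proof.
apply/forallP/and3P => [PP|[Pr Pa Pb]]; first by split; apply: PP.
by case.
Qed.

(** The cluster is reachable from every world and is never left, so the value does not depend on
    [w]. *)
Lemma sat_Box_Dia (V : nat -> pred world) (w : world) (g : formula) :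
  sat world_rel V w (Box (Dia g))
    = sat world_rel V wa g || sat world_rel V wb g.
Proof.
by rewrite /= !forall_world; case: w => /=; do !case: (sat _ _ _ g).
Qed.

Lemma sat_Dia_Box (V : nat -> pred world) (w : world) (g : formula) :
  sat world_rel V w (Dia (Box g))
    = sat world_rel V wa g && sat world_rel V wb g.
Proof.
by rewrite /= !forall_world; case: w => /=; do !case: (sat _ _ _ g).
Qed.

(** * Literal types and descriptions of pointed models *)

Section LiteralTypes.
Variables A B : seq nat.

(** Inclusion of literal types, with positive literals over [A] and negative ones over [B]; hence
    the second implication runs backwards. *)
Definition type_le (W W' : Type) (V : nat -> pred W) (x : W)
    (V' : nat -> pred W') (x' : W') : Prop :=
  {in A, forall p, V p x -> V' p x'} /\ {in B, forall p, V' p x' -> V p x}.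

Definition literals (W : Type) (V : nat -> pred W) (x : W) : formula :=
  And (bigAnd [seq Var p | p <- A & V p x])
      (bigAnd [seq Neg (Var p) | p <- B & ~~ V p x]).

Lemma sat_literals (W W' : finType) (R : rel W') (V : nat -> pred W) (x : W)
    (V' : nat -> pred W') (x' : W') :
  reflect (type_le V x V' x') (sat R V' x' (literals V x)).
Proof.
rewrite /= !sat_bigAnd !all_map !all_filter.
apply: (iffP andP) => [[/allP VA /allP VB]|[VA VB]].
  split=> p; first by move=> /VA /implyP.
  by move=> /VB /= /implyP nV V'p; apply: contraLR V'p.
split; apply/allP => p ps; apply/implyP; first exact: VA.
by apply: contra; apply: VB.
Qed.

Lemma pvars_literals (s : bool) (W : Type) (V : nat -> pred W) (x : W) (p : nat) :
  p \in pvars s (literals V x) -> p \in (if s then A else B).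
Proof.
rewrite /= !pvars_bigAnd mem_cat -!map_comp.
by case: s => /orP[] /flatten_mapP[q]; rewrite ?mem_filter => /andP[_ qs] //=;
  rewrite inE => /eqP->.
Qed.

Definition description (V : nat -> pred world) (w : world) : formula :=
  bigAnd [:: literals V w; Box (Dia (literals V wa)); Box (Dia (literals V wb));
             Dia (Box (Or (literals V wa) (literals V wb)))].

Lemma pvars_description (s : bool) (V : nat -> pred world) (w : world) (p : nat) :
  p \in pvars s (description V w) -> p \in (if s then A else B).
Proof.
rewrite pvars_bigAnd.
have -> : [seq pvars s i | i <- [:: literals V w; Box (Dia (literals V wa));
    Box (Dia (literals V wb)); Dia (Box (Or (literals V wa) (literals V wb)))]]
  = [:: pvars s (literals V w); pvars s (literals V wa); pvars s (literals V wb);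
        pvars s (literals V wa) ++ pvars s (literals V wb)] by case: s.
have [] := (@pvars_literals s _ V w p, @pvars_literals s _ V wa p,
            @pvars_literals s _ V wb p).
move: (pvars s _) (pvars s _) (pvars s _) => lw la lb [lwP laP] lbP.
rewrite /flatten /foldr cats0 !mem_cat.
by case/orP=> [|/orP[|/orP[|/orP[]]]]; auto.
Qed.

Definition cluster_perm (s : bool) (w : world) : world :=
  match w with
  | wr => wr
  | wa => if s then wb else wa
  | wb => if s then wa else wb
  end.

Lemma sat_description (V V' : nat -> pred world) (w w' : world) :
  reflect (type_le V w V' w' /\
           exists s, type_le V wa V' (cluster_perm s wa) /\
                     type_le V wb V' (cluster_perm s wb))
          (sat world_rel V' w' (description V w)).
Proof.
rewrite sat_bigAnd /all !sat_Box_Dia sat_Dia_Box andbT.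
have satOr x g h : sat world_rel V' x (Or g h)
    = sat world_rel V' x g || sat world_rel V' x h by [].
have typeP x x' := sat_literals world_rel V x V' x'.
apply: (iffP and4P) => [[/typeP ww' a_le b_le /andP[le_a le_b]]|].
  split=> //; move: a_le b_le le_a le_b; rewrite !satOr.
  (* The four comparisons form a 2 by 2 table with a true entry in each row and column, so its
     diagonal or its antidiagonal is entirely true. *)
  case: (typeP wa wa) => aa; case: (typeP wa wb) => ab;
    case: (typeP wb wa) => ba; case: (typeP wb wb) => bb //= _ _ _ _;
    by [exists true | exists false].
case=> /typeP ww' [s [/typeP a_le /typeP b_le]].
by case: s a_le b_le => a_le b_le; rewrite !satOr a_le b_le !orbT.
Qed.

End LiteralTypes.

(** Projection of the common model to one of its two components. The world [w] may lie in the
    cluster, in which case the whole frame is mapped into the cluster. *)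
Definition reroot (w : world) (s : bool) (x : world) : world :=
  if x is wr then w else cluster_perm s x.

Lemma reroot_forth (w : world) (s : bool) (x y : world) :
  world_rel x y -> world_rel (reroot w s x) (reroot w s y).
Proof. by case: w s x y => [] [] [] []. Qed.

Lemma reroot_back (w : world) (s : bool) (x z : world) :
  world_rel (reroot w s x) z -> exists2 y, world_rel x y & reroot w s y = z.
Proof.
by case: w s x z => [] [] [] [] //= _;
  do ?[by exists wr | by exists wa | by exists wb].
Qed.

Section FiniteValuations.
Variable n : nat.

(** Coding valuations in a finite type lets a disjunction range over all of them; variables from [n]
    on are false everywhere. *)
Definition valuation_of (F : {set 'I_n * world}) : nat -> pred world :=
  fun p w => if insub p is Some i then (i, w) \in F else false.

Definition trace (V : nat -> pred world) : {set 'I_n * world} :=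
  [set iw : 'I_n * world | V iw.1 iw.2].

Lemma trace_valuation_of (V : nat -> pred world) (p : nat) :
  p < n -> valuation_of (trace V) p =1 V p.
Proof. by move=> pn w; rewrite /valuation_of insubT inE. Qed.

End FiniteValuations.

(** * The interpolant and its two entailments *)

Section Interpolant.
Variables (phi : formula) (Ppos Pneg : seq nat).

Let A := [seq p <- vpos phi | p \notin Ppos].
Let B := [seq p <- vneg phi | p \notin Pneg].
Let n := (\max_(p <- vpos phi ++ vneg phi) p).+1.

Definition interpolant : formula :=
  bigOr [seq description A B (valuation_of Fw.1) Fw.2 |
           Fw <- enum [pred Fw : {set 'I_n * world} * world
                        | sat world_rel (valuation_of Fw.1) Fw.2 phi]].

Lemma pvars_interpolant (s : bool) (p : nat) :
  p \in pvars s interpolant -> p \in (if s then A else B).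
Proof.
rewrite /interpolant pvars_bigOr -map_comp => /flatten_mapP[Fw _].
exact: pvars_description.
Qed.

Lemma interpolant_intro : Gamma_LS_2_1 (Imp phi interpolant).
Proof.
move=> V w; apply/sat_ImpP => Vphi; rewrite /interpolant sat_bigOr has_map.
have VF p : p \in vpos phi ++ vneg phi -> valuation_of (trace n V) p =1 V p.
  by move=> pphi; apply: trace_valuation_of; rewrite ltnS leq_bigmax_seq.
(* The pointed model satisfies its own description, with the identity matching ([false]). *)
apply/hasP; exists (trace n V, w); first by rewrite mem_enum inE /= (sat_ext _ VF).
apply/sat_description; split; last exists false; do ?split; move=> p;
  rewrite mem_filter => /andP[_ pphi];
  by rewrite VF // mem_cat pphi ?orbT.
Qed.

Lemma interpolant_elim (psi : formula) :
    Gamma_LS_2_1 (Imp phi psi) -> avoids (vpos psi) Ppos ->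
    avoids (vneg psi) Pneg ->
  Gamma_LS_2_1 (Imp interpolant psi).
Proof.
move=> phi_psi psiP psiN V' w'; apply/sat_ImpP; rewrite /interpolant sat_bigOr has_map.
case/hasP=> -[F w]; rewrite mem_enum inE /=.
set V := valuation_of F => Vphi /sat_description[ww' [s [aa bb]]].
(* Only [f'] permutes the cluster, so that [f x] and [f' x] are always matched worlds. *)
pose f := reroot w false; pose f' := reroot w' s.
have le x : type_le A B V (f x) V' (f' x) by case: x.
(* The least valuation allowed by the transfers of [phi] and [psi]. *)
pose N p x := (p \in vpos phi) && V p (f x) || (p \notin Pneg) && V' p (f' x).
have Nphi : sat world_rel N wr phi.
  apply: (sat_bounded_morphism (@reroot_forth w false) (@reroot_back w false)
            (V1 := N) (V2 := V) (g := phi) (s := false) _ _ wr) => //.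
  - move=> p pphi x /orP[/andP[_ //]|/andP[pN]].
    (* Here [p] is negative in [phi] and outside [Pneg], hence in [B], so its truth passes from [V']
       to [V]. *)
    by apply: (proj2 (le x)); rewrite mem_filter pN.
  - by move=> p pphi x Vp; rewrite /N pphi Vp.
have Npsi := sat_ImpP _ _ _ _ _ (phi_psi N wr) Nphi.
apply: (sat_bounded_morphism (@reroot_forth w' s) (@reroot_back w' s)
          (V1 := N) (V2 := V') (g := psi) (s := true) _ _ wr) => //.
- move=> p /psiP pP x /orP[/andP[pphi]|/andP[_ //]].
  (* Being positive in [psi], [p] avoids [Ppos]; being positive in [phi] too, it lies in [A], so its
     truth passes from [V] to [V']. *)
  by apply: (proj1 (le x)); rewrite mem_filter pP.
- by move=> p /psiN pN x V'p; rewrite /N pN V'p orbT.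
Qed.

End Interpolant.

Theorem theorem6p2 : uniform_Lyndon_interpolation Gamma_LS_2_1.
Proof.
move=> phi Ppos Pneg; exists (interpolant phi Ppos Pneg); split.
- exact: interpolant_intro.
- by move=> p /pvars_interpolant; rewrite mem_filter => /andP[].
- by move=> p /pvars_interpolant; rewrite mem_filter => /andP[].
- exact: interpolant_elim.
Qed.
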